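(* Let the real data $L=(L_{11},L_{22},L_{12})$ and $U=(U_{11},U_{22},U_{12})$ satisfy $L\le U$ and $L_{jj}\ge 0$ for $j=1,2$, and consider the nonconvex quadratic system (S) in the variables $(W_{11},W_{22},W_{12},T_{12})\in\mathbb{R}^4$: $$L_{jj}\le W_{jj}\le U_{jj}\ (j=1,2),\quad L_{12}W_{12}\le T_{12}\le U_{12}W_{12},\quad W_{12}\ge 0,\quad W_{11}W_{22}=W_{12}^2+T_{12}^2.$$ The pair of linear inequalities $$\text{(A1)}\quad \pi_0+\pi_1W_{11}+\pi_2W_{22}+\pi_3W_{12}+\pi_4T_{12}\ \ge\ U_{22}W_{11}+U_{11}W_{22}-U_{11}U_{22},$$ $$\text{(A2)}\quad \pi_0+\pi_1W_{11}+\pi_2W_{22}+\pi_3W_{12}+\pi_4T_{12}\ \ge\ L_{22}W_{11}+L_{11}W_{22}-L_{11}L_{22},$$ whose coefficients $\pi_0,\dots,\pi_4$ are given in the context, are the inequalities $$\text{(B1)}\quad (r+R)R(\mu^2-ss^T\bullet X)+(r+R)(\lambda+\mu)\,sb^T\bullet X\ \ge\ (\mu^2+\lambda\mu)(\mathrm{tr}(X)+rR),$$ $$\text{(B2)}\quad (r+R)(\lambda+\mu)\,sb^T\bullet X-(r+R)r(ss^T\bullet X-\lambda^2)\ \ge\ (\lambda^2+\lambda\mu)(\mathrm{tr}(X)+rR)$$ tailored to the system (S).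
   Context: Coefficients in (A1), (A2): $$\pi_0:=-\sqrt{L_{11}L_{22}U_{11}U_{22}},\quad \pi_1:=-\sqrt{L_{22}U_{22}},\quad \pi_2:=-\sqrt{L_{11}U_{11}},$$ $$\pi_3:=(\sqrt{L_{11}}+\sqrt{U_{11}})(\sqrt{L_{22}}+\sqrt{U_{22}})\,\frac{1-f(L_{12})f(U_{12})}{1+f(L_{12})f(U_{12})},$$ $$\pi_4:=(\sqrt{L_{11}}+\sqrt{U_{11}})(\sqrt{L_{22}}+\sqrt{U_{22}})\,\frac{f(L_{12})+f(U_{12})}{1+f(L_{12})f(U_{12})},$$ where $f(t):=(\sqrt{1+t^2}-1)/t$ for $t\ne 0$ and $f(0):=0$. (A1), (A2) were derived by Chen et al. for the optimal power flow problem and are valid for the convex hull of the solution set of (S). Origin of (B1), (B2): they are linear inequalities in a symmetric matrix $X$ (standing for $xx^T$), valid for $\mathrm{conv}\{(x,xx^T)\}$ over all $x$ with $r\le\|x\|\le R$ and $\|x\|\le b^Tx$, where $0\le\lambda\le s^Tx\le\mu$ is a pair of linear bounds valid for all such $x$; here $M\bullet X:=\mathrm{tr}(M^TX)$ and $\|\cdot\|$ is the Euclidean norm. Meaning of ''tailored to (S)'': a point of (S) corresponds to $x\in\mathbb{R}^3$ via $W_{11}=x_1^2+x_2^2$, $W_{22}=x_3^2$, $W_{12}=x_1x_3$, $T_{12}=x_2x_3$, so in the lifted matrix variable $X\in\mathbb{R}^{3\times 3}$ one identifies $(W_{11},W_{22},W_{12},T_{12})=(X_{11}+X_{22},X_{33},X_{13},X_{23})$.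 In (B1), (B2) the vector $(x_1,x_2)$ takes the role of $x$, the variable $x_3$ takes the role of $s^Tx$ (so $\mathrm{tr}(X)$, $ss^T\bullet X$, $sb^T\bullet X$ become $X_{11}+X_{22}$, $X_{33}$, $b_1X_{13}+b_2X_{23}$), and $r,R,\lambda,\mu$ are $\sqrt{L_{11}},\sqrt{U_{11}},\sqrt{L_{22}},\sqrt{U_{22}}$. The vector $b=(b_1,b_2)$ is the one for which $\|(x_1,x_2)\|\le b_1x_1+b_2x_2$ describes the cone $\{x_1\ge 0,\ L_{12}x_1\le x_2\le U_{12}x_1\}$; when $U_{12}>L_{12}$ it is the unique solution of $b_1+L_{12}b_2=\sqrt{1+L_{12}^2}$, $b_1+U_{12}b_2=\sqrt{1+U_{12}^2}$. *)

(* Defs.v *)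
From HB Require Import structures.
From mathcomp Require Import all_boot all_order all_algebra.
From mathcomp Require Import ring.
Set Implicit Arguments.
Unset Strict Implicit.
Unset Printing Implicit Defensive.
Import Order.TTheory GRing.Theory Num.Theory.
Local Open Scope ring_scope.

(** * Inequalities [lhs >= rhs] as objects *)

Record ineq (K : rcfType) (T : Type) := Ge { lhs : T -> K; rhs : T -> K }.

Definition holds (K : rcfType) (T : Type) (p : ineq K T) (x : T) : Prop :=
  lhs p x >= rhs p x.

Definition ineq_comp (K : rcfType) (T T' : Type) (p : ineq K T) (g : T' -> T) :
  ineq K T' := Ge (fun x => lhs p (g x)) (fun x => rhs p (g x)).

(* Two inequalities are identified when they differ only by moving terms
   between the two sides; this is finer than having the same solutions. *)
Definition same_ineq (K : rcfType) (T : Type) (D : T -> Prop) (p q : ineq K T) :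
  Prop := forall x, D x -> lhs p x - rhs p x = lhs q x - rhs q x.

Lemma same_ineq_holds (K : rcfType) (T : Type) (D : T -> Prop) (p q : ineq K T) :
  same_ineq D p q -> forall x, D x -> holds p x <-> holds q x.
Proof.
by move=> pq x Dx; rewrite /holds -subr_ge0 (pq x Dx) subr_ge0.
Qed.

(** * The system (S) and the inequalities (A1), (A2) *)

Record bounds (K : rcfType) := Bounds { d11 : K; d22 : K; d12 : K }.

Record point (K : rcfType) := Point { W11 : K; W22 : K; W12 : K; T12 : K }.

Definition system_S (K : rcfType) (L U : bounds K) (w : point K) : Prop :=
  [/\ d11 L <= W11 w <= d11 U,
      d22 L <= W22 w <= d22 U,
      d12 L * W12 w <= T12 w <= d12 U * W12 w,
      0 <= W12 w
    & W11 w * W22 w = W12 w ^+ 2 + T12 w ^+ 2].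

Definition f (K : rcfType) (t : K) : K :=
  if t == 0 then 0 else (Num.sqrt (1 + t ^+ 2) - 1) / t.

Section Pi.
Variables (K : rcfType) (L U : bounds K).

Definition pi0 : K := - Num.sqrt (d11 L * d22 L * d11 U * d22 U).
Definition pi1 : K := - Num.sqrt (d22 L * d22 U).
Definition pi2 : K := - Num.sqrt (d11 L * d11 U).
Definition pi3 : K :=
  (Num.sqrt (d11 L) + Num.sqrt (d11 U)) * (Num.sqrt (d22 L) + Num.sqrt (d22 U))
  * ((1 - f (d12 L) * f (d12 U)) / (1 + f (d12 L) * f (d12 U))).
Definition pi4 : K :=
  (Num.sqrt (d11 L) + Num.sqrt (d11 U)) * (Num.sqrt (d22 L) + Num.sqrt (d22 U))
  * ((f (d12 L) + f (d12 U)) / (1 + f (d12 L) * f (d12 U))).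

Definition A1 : ineq K (point K) :=
  Ge (fun w => pi0 + pi1 * W11 w + pi2 * W22 w + pi3 * W12 w + pi4 * T12 w)
     (fun w => d22 U * W11 w + d11 U * W22 w - d11 U * d22 U).

Definition A2 : ineq K (point K) :=
  Ge (fun w => pi0 + pi1 * W11 w + pi2 * W22 w + pi3 * W12 w + pi4 * T12 w)
     (fun w => d22 L * W11 w + d11 L * W22 w - d11 L * d22 L).

End Pi.

(** * The inequalities (B1), (B2) *)

(* [trX], [ssX], [sbX] are the linear forms standing for ||x||^2, (s^T x)^2 and
   (s^T x)(b^T x) in the lifted variable. *)
Definition B1_form (K : rcfType) (T : Type) (r R lam mu : K)
    (trX ssX sbX : T -> K) : ineq K T :=
  Ge (fun X => (r + R) * R * (mu ^+ 2 - ssX X) + (r + R) * (lam + mu) * sbX X)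
     (fun X => (mu ^+ 2 + lam * mu) * (trX X + r * R)).

Definition B2_form (K : rcfType) (T : Type) (r R lam mu : K)
    (trX ssX sbX : T -> K) : ineq K T :=
  Ge (fun X => (r + R) * (lam + mu) * sbX X - (r + R) * r * (ssX X - lam ^+ 2))
     (fun X => (lam ^+ 2 + lam * mu) * (trX X + r * R)).

Definition mxdot (K : rcfType) (n : nat) (M X : 'M[K]_n) : K := \tr (M^T *m X).

Definition B1 (K : rcfType) (n : nat) (r R lam mu : K) (s b : 'cV[K]_n) :
  ineq K 'M[K]_n :=
  B1_form r R lam mu (fun X => \tr X)
    (fun X => mxdot (s *m s^T) X) (fun X => mxdot (s *m b^T) X).

Definition B2 (K : rcfType) (n : nat) (r R lam mu : K) (s b : 'cV[K]_n) :
  ineq K 'M[K]_n :=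
  B2_form r R lam mu (fun X => \tr X)
    (fun X => mxdot (s *m s^T) X) (fun X => mxdot (s *m b^T) X).

(** * Tailoring to (S) *)

Definition enorm (K : rcfType) (n : nat) (x : 'cV[K]_n) : K :=
  Num.sqrt (\sum_i x i 0 ^+ 2).

Definition describes_cone (K : rcfType) (L U : bounds K) (b : 'cV[K]_2) : Prop :=
  forall v : 'cV[K]_2,
    enorm v <= (b^T *m v) 0 0 <->
    0 <= v 0 0 /\ d12 L * v 0 0 <= v 1 0 <= d12 U * v 0 0.

(* Matrix indices are 0-based: [X 0 2] is X_13. *)
Definition point_of (K : rcfType) (X : 'M[K]_3) : point K :=
  Point (X 0 0 + X 1 1) (X 2 2) (X 0 2) (X 1 2).

Definition sym_mx (K : rcfType) (n : nat) (X : 'M[K]_n) : Prop := X^T = X.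

(* The constraints r <= ||x|| <= R, ||x|| <= b^T x, lam <= s^T x <= mu, with
   (x_1, x_2) for x and x_3 for s^T x. *)
Definition tailored_set (K : rcfType) (L U : bounds K) (b : 'cV[K]_2)
    (x : 'cV[K]_3) : Prop :=
  let v : 'cV[K]_2 := @usubmx K 2 1 1 x in
  [/\ Num.sqrt (d11 L) <= enorm v <= Num.sqrt (d11 U),
      enorm v <= (b^T *m v) 0 0
    & Num.sqrt (d22 L) <= x 2 0 <= Num.sqrt (d22 U)].

Definition B1_tailored (K : rcfType) (L U : bounds K) (b : 'cV[K]_2) :
  ineq K 'M[K]_3 :=
  B1_form (Num.sqrt (d11 L)) (Num.sqrt (d11 U))
    (Num.sqrt (d22 L)) (Num.sqrt (d22 U))
    (fun X : 'M_3 => X 0 0 + X 1 1) (fun X : 'M_3 => X 2 2)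
    (fun X : 'M_3 => b 0 0 * X 0 2 + b 1 0 * X 1 2).

Definition B2_tailored (K : rcfType) (L U : bounds K) (b : 'cV[K]_2) :
  ineq K 'M[K]_3 :=
  B2_form (Num.sqrt (d11 L)) (Num.sqrt (d11 U))
    (Num.sqrt (d22 L)) (Num.sqrt (d22 U))
    (fun X : 'M_3 => X 0 0 + X 1 1) (fun X : 'M_3 => X 2 2)
    (fun X : 'M_3 => b 0 0 * X 0 2 + b 1 0 * X 1 2).

(* When x_3 really is s^T (x_1, x_2), the lifted matrix is [P *m Y *m P^T] with
   Y the lift of (x_1, x_2), and the three tailored forms are those of
   [B1], [B2] at Y. *)
Lemma tailored_forms (K : rcfType) (s b : 'cV[K]_2) (Y : 'M[K]_2) :
  sym_mx Y ->
  let P : 'M[K]_(3, 2) := @col_mx K 2 1 2 1%:M s^T in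
  let X : 'M[K]_3 := P *m Y *m P^T in
  [/\ X 0 0 + X 1 1 = \tr Y,
      X 2 2 = mxdot (s *m s^T) Y
    & b 0 0 * X 0 2 + b 1 0 * X 1 2 = mxdot (s *m b^T) Y].
Proof.
move=> symY P X.
have o0 : (0 : 'I_3) = lshift 1 (0 : 'I_2) by apply: val_inj.
have o1 : (1 : 'I_3) = lshift 1 (1 : 'I_2) by apply: val_inj.
have o2 : (2 : 'I_3) = rshift 2 (0 : 'I_1) by apply: val_inj.
have Pu (i j : 'I_2) : P (lshift 1 i) j = (i == j)%:R.
  by apply: etrans (@col_mxEu K 2 1 2 1%:M s^T i j) _; rewrite mxE.
have P00 : P 0 0 = 1 by rewrite o0 Pu.
have P01 : P 0 1 = 0 by rewrite o0 Pu.
have P10 : P 1 0 = 0 by rewrite o1 Pu.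
have P11 : P 1 1 = 1 by rewrite o1 Pu.
have P2 j : P 2 j = s j 0.
  by rewrite o2; apply: etrans (@col_mxEd K 2 1 2 1%:M s^T 0 j) _; rewrite mxE.
have XE i j : X i j = P i 0 * (Y 0 0 * P j 0 + Y 0 1 * P j 1)
                    + P i 1 * (Y 1 0 * P j 0 + Y 1 1 * P j 1).
  rewrite /X -mulmxA !mxE !big_ord_recl big_ord0 addr0 !mxE !big_ord_recl !big_ord0.
  rewrite !addr0 !mxE.
  by rewrite (_ : lift ord0 ord0 = 1 :> 'I_2) //; apply: val_inj.
have symY01 : Y 1 0 = Y 0 1 by rewrite -[in LHS]symY mxE.
have l1 : lift ord0 ord0 = 1 :> 'I_2 by apply: val_inj.
have dotE c : mxdot (s *m c^T) Y =
    c 0 0 * (s 0 0 * Y 0 0 + s 1 0 * Y 1 0)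
    + c 1 0 * (s 0 0 * Y 0 1 + s 1 0 * Y 1 1).
  rewrite /mxdot /mxtrace !big_ord_recl big_ord0 !mxE !big_ord_recl !big_ord0 !mxE.
  by rewrite !big_ord_recl !big_ord0 !mxE !l1; ring.
split.
- rewrite !XE P00 P01 P10 P11 /mxtrace !big_ord_recl big_ord0 l1; ring.
- rewrite dotE XE !P2; ring.
- rewrite dotE !XE P00 P01 P10 P11 !P2 symY01; ring.
Qed.

Lemma B_tailoredE (K : rcfType) (L U : bounds K) (s b : 'cV[K]_2) (Y : 'M[K]_2) :
  sym_mx Y ->
  let P : 'M[K]_(3, 2) := @col_mx K 2 1 2 1%:M s^T in
  let X : 'M[K]_3 := P *m Y *m P^T in
  let r := Num.sqrt (d11 L) in let R := Num.sqrt (d11 U) in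
  let lam := Num.sqrt (d22 L) in let mu := Num.sqrt (d22 U) in
  (holds (B1_tailored L U b) X <-> holds (B1 r R lam mu s b) Y) /\
  (holds (B2_tailored L U b) X <-> holds (B2 r R lam mu s b) Y).
Proof.
move=> symY P X r R lam mu.
have [trE ssE sbE] := tailored_forms s b symY.
by rewrite /holds /= -/P -/X in trE ssE sbE *; rewrite trE ssE sbE.
Qed.

(* Main.v *)
(* With p = f L12 and q = f U12 (half-angle tangents of the two boundary rays),
   the vector b = ((1 - pq) / (1 + pq), (p + q) / (1 + pq)) satisfies
     (1 + pq)^2 ((b.v)^2 - |v|^2)
       = ((1 - p^2) v2 - 2 p v1) (2 q v1 - (1 - q^2) v2),
   and the two factors are positive multiples of v2 - L12 v1 and U12 v1 - v2:
   hence b describes the cone.  Conversely, a describing vector is tight on both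
   boundary rays, which determines it when L12 < U12; when L12 = U12 a component
   orthogonal to the single ray would put further vectors in the cone.  Given b,
   (A1), (A2) and the tailored (B1), (B2) agree by expansion. *)
Require Import Defs.
From mathcomp Require Import all_boot all_order all_algebra.
From mathcomp Require Import ring lra.
Import Order.TTheory GRing.Theory Num.Theory.
Set Implicit Arguments.
Unset Strict Implicit.
Unset Printing Implicit Defensive.
Local Open Scope ring_scope.

(** * Square roots and the half-angle function [f] *)

Lemma ler_sqrtl (K : rcfType) (a c : K) :
  (Num.sqrt a <= c) = (0 <= c) && (a <= c ^+ 2).
Proof.
have [c0|c0] := leP 0 c; last first.
  by apply/negbTE; rewrite -ltNge (lt_le_trans c0) ?sqrtr_ge0.
by rewrite -{1}(ger0_norm c0) -sqrtr_sqr ler_sqrt ?sqr_ge0.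
Qed.

Lemma normr_lt_sqrt1D (K : rcfType) (t : K) : `|t| < Num.sqrt (1 + t ^+ 2).
Proof. by rewrite -sqrtr_sqr ltr_sqrt ?ltrDr ?ltr01 // ltr_pwDl ?sqr_ge0. Qed.

Lemma sqr_sqrt1D (K : rcfType) (t : K) : Num.sqrt (1 + t ^+ 2) ^+ 2 = 1 + t ^+ 2.
Proof. by rewrite sqr_sqrtr // addr_ge0 ?sqr_ge0. Qed.

(** Multiplying by the conjugate turns the quotient into one whose denominator is always positive,
    which absorbs the case [t = 0]. *)
Lemma fE (K : rcfType) (t : K) : f t = t / (1 + Num.sqrt (1 + t ^+ 2)).
Proof.
rewrite /f; have [->|t0] := eqVneq t 0; first by rewrite mul0r.
have s0 := sqrtr_ge0 (1 + t ^+ 2).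
have s2 := sqr_sqrt1D t.
have s1 : 1 + Num.sqrt (1 + t ^+ 2) != 0 by rewrite gt_eqF //; lra.
apply/eqP; rewrite eqr_div //; apply/eqP; move: s2; set s := Num.sqrt _ => s2.
by rewrite -expr2 (_ : (s - 1) * (1 + s) = s ^+ 2 - 1); [rewrite s2|]; ring.
Qed.

Lemma f_norm_lt1 (K : rcfType) (t : K) : `|f t| < 1.
Proof.
have ts := normr_lt_sqrt1D t; have s0 := sqrtr_ge0 (1 + t ^+ 2).
have s1 : 0 < 1 + Num.sqrt (1 + t ^+ 2) by lra.
by rewrite fE normrM normfV (gtr0_norm s1) ltr_pdivrMr // mul1r; lra.
Qed.

(** Double-angle formula: if [t] is the tangent of an angle, [f t] is the tangent of its half. *)
Lemma f_double (K : rcfType) (t : K) : t * (1 - f t ^+ 2) = 2 * f t.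
Proof.
have s0 := sqrtr_ge0 (1 + t ^+ 2).
have s2 := sqr_sqrt1D t.
have s1 : 1 + Num.sqrt (1 + t ^+ 2) != 0 by rewrite gt_eqF //; lra.
move: s0 s2 s1; rewrite fE; set s := Num.sqrt _ => s0 s2 s1.
have -> : t * (1 - (t / (1 + s)) ^+ 2)
        = t * ((1 + s) ^+ 2 - t ^+ 2) / (1 + s) ^+ 2 by field.
have -> : t ^+ 2 = s ^+ 2 - 1 by rewrite s2; ring.
by field.
Qed.

(** * The wedge described by the half-angle vector *)

Lemma half_angle_cone (K : rcfType) (l u p q x y : K) :
    `|p| < 1 -> `|q| < 1 -> l * (1 - p ^+ 2) = 2 * p -> u * (1 - q ^+ 2) = 2 * q ->
    l <= u ->
  (Num.sqrt (x ^+ 2 + y ^+ 2)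
     <= (1 - p * q) / (1 + p * q) * x + (p + q) / (1 + p * q) * y)
  <-> 0 <= x /\ l * x <= y <= u * x.
Proof.
rewrite !ltr_norml => /andP[p1 p2] /andP[q1 q2] lp uq lu.
have P0 : 0 < 1 - p ^+ 2 by nra.
have Q0 : 0 < 1 - q ^+ 2 by nra.
have D0 : 0 < 1 + p * q by nra.
pose A := (1 - p ^+ 2) * y - 2 * p * x.
pose B := 2 * q * x - (1 - q ^+ 2) * y.
pose N := (1 - p * q) * x + (p + q) * y.
have AE : A = (1 - p ^+ 2) * (y - l * x) by rewrite /A -lp; ring.
have BE : B = (1 - q ^+ 2) * (u * x - y) by rewrite /B -uq; ring.
have A0 : (0 <= A) = (l * x <= y) by rewrite AE pmulr_rge0 // subr_ge0.
have B0 : (0 <= B) = (y <= u * x) by rewrite BE pmulr_rge0 // subr_ge0.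
(* Eliminating [y] in favour of [A] or of [B]; the sign of [p + q] decides which of the two
   identities transfers nonnegativity between [N] and [x]. *)
have NA : (1 - p ^+ 2) * N = (1 + p ^+ 2) * (1 + p * q) * x + (p + q) * A.
  by rewrite /N /A; ring.
have NB : (1 - q ^+ 2) * N = (1 + q ^+ 2) * (1 + p * q) * x - (p + q) * B.
  by rewrite /N /B; ring.
have ABx : (1 - q ^+ 2) * A + (1 - p ^+ 2) * B
         = (1 - p ^+ 2) * (1 - q ^+ 2) * (u - l) * x by rewrite AE BE; ring.
have CP : 0 < (1 + p ^+ 2) * (1 + p * q) by rewrite mulr_gt0 //; nra.
have CQ : 0 < (1 + q ^+ 2) * (1 + p * q) by rewrite mulr_gt0 //; nra.
have -> : (1 - p * q) / (1 + p * q) * x + (p + q) / (1 + p * q) * y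
        = N / (1 + p * q) by rewrite /N; field; lra.
rewrite ler_sqrtl pmulr_lge0 ?invr_gt0 // expr_div_n ler_pdivlMr ?exprn_gt0 //.
rewrite -(subr_ge0 _ (N ^+ 2)).
have -> : N ^+ 2 - (x ^+ 2 + y ^+ 2) * (1 + p * q) ^+ 2 = A * B.
  by rewrite /N /A /B; ring.
rewrite -A0 -B0; split=> [/andP[N0 AB0]|[x0 /andP[A_ge0 B_ge0]]]; last first.
  rewrite mulr_ge0 // andbT; have [pq0|pq0] := leP 0 (p + q).
    by rewrite -(pmulr_rge0 _ P0) NA addr_ge0 // mulr_ge0 // ltW.
  have pqB : (p + q) * B <= 0 by rewrite nmulr_rle0.
  by rewrite -(pmulr_rge0 _ Q0) NB subr_ge0 (le_trans pqB) // mulr_ge0 // ltW.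
have PN : 0 <= (1 - p ^+ 2) * N by rewrite mulr_ge0 // ltW.
have QN : 0 <= (1 - q ^+ 2) * N by rewrite mulr_ge0 // ltW.
have [[A_ge0 B_ge0]|[A_le0 B_le0]] : 0 <= A /\ 0 <= B \/ A <= 0 /\ B <= 0.
- have [A_gt0|A_lt0|A_eq0] := ltgtP 0 A.
  + by left; split=> //; rewrite -(pmulr_rge0 _ A_gt0).
  + by right; split=> //; rewrite -(nmulr_rge0 _ A_lt0).
  + by have [B0'|B0'] := leP 0 B; [left | right]; split=> //; apply: ltW.
- split; last by apply/andP.
  have [pq0|pq0] := leP 0 (p + q).
    rewrite -(pmulr_rge0 _ CQ); have := mulr_ge0 pq0 B_ge0; lra.
  rewrite -(pmulr_rge0 _ CP).
  have : (p + q) * A <= 0 by rewrite nmulr_rle0.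
  lra.
(* With both factors nonpositive, [x >= 0] makes the weighted sum in [ABx] nonnegative, so both
   factors vanish and the point still lies in the wedge. *)
- have x0 : 0 <= x.
    have [pq0|pq0] := leP 0 (p + q).
      rewrite -(pmulr_rge0 _ CP); have := mulr_ge0_le0 pq0 A_le0; lra.
    rewrite -(pmulr_rge0 _ CQ).
    have : 0 <= (p + q) * B by rewrite nmulr_rge0.
    lra.
  have AB : 0 <= (1 - q ^+ 2) * A + (1 - p ^+ 2) * B.
    by rewrite ABx !mulr_ge0 ?subr_ge0 // ?(ltW P0) ?(ltW Q0) //; lra.
  have QA : (1 - q ^+ 2) * A <= 0 by rewrite pmulr_rle0.
  have PB : (1 - p ^+ 2) * B <= 0 by rewrite pmulr_rle0.
  split=> //; rewrite -(pmulr_rge0 A Q0) -(pmulr_rge0 B P0).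
  apply/andP; lra.
Qed.

(** * Uniqueness of the vector describing a wedge *)

Definition describes_wedge (K : rcfType) (l u b1 b2 : K) : Prop :=
  forall x y : K, (Num.sqrt (x ^+ 2 + y ^+ 2) <= b1 * x + b2 * y)
    <-> 0 <= x /\ l * x <= y <= u * x.

Lemma wedge_tight_left (K : rcfType) (l u b1 b2 : K) :
  l <= u -> describes_wedge l u b1 b2 -> b1 + b2 * l = Num.sqrt (1 + l ^+ 2).
Proof.
move=> lu H; set s := Num.sqrt _.
have s0 : 0 <= s by apply: sqrtr_ge0.
have s2 : s ^+ 2 = 1 + l ^+ 2 := sqr_sqrt1D l.
have ls : `|l| < s := normr_lt_sqrt1D l.
apply/eqP; rewrite eq_le; apply/andP; split; last first.
  have /H : 0 <= 1 :> K /\ l * 1 <= l <= u * 1 by rewrite !mulr1 lexx ler01.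
  by rewrite expr1n mulr1.
(* A slack would put (1, l - e), which lies outside the cone, into it. *)
rewrite leNgt; apply/negP => gap.
have g0 : 0 < b1 + b2 * l - s by rewrite subr_gt0.
have n0 : 0 < 1 + `|b2| by rewrite ltr_wpDr.
(* Lowering [l] by [e] costs the linear form at most [e * |b2|], so this share of the slack leaves
   the value at least [s + e], which bounds the norm of [(1, l - e)] because [- l < s]. *)
pose e := (b1 + b2 * l - s) / (1 + `|b2|).
have e0 : 0 < e by rewrite divr_gt0.
have eE : e * (1 + `|b2|) = b1 + b2 * l - s by rewrite divfK // gt_eqF.
have eb : e * b2 <= e * `|b2| by rewrite ler_pM2l ?ler_norm.
have : Num.sqrt (1 ^+ 2 + (l - e) ^+ 2) <= b1 * 1 + b2 * (l - e).
  apply: (@le_trans _ _ (s + e)); last by lra.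
  rewrite ler_sqrtl addr_ge0 ?(ltW e0) //=.
  have : 0 <= e * (s + l).
    by rewrite mulr_ge0 ?(ltW e0) //; move: ls; rewrite ltr_norml => /andP[]; lra.
  have -> : (s + e) ^+ 2 = 1 + l ^+ 2 + 2 * (e * s) + e ^+ 2 by rewrite -s2; ring.
  have -> : 1 ^+ 2 + (l - e) ^+ 2 = 1 + l ^+ 2 - 2 * (e * l) + e ^+ 2 by ring.
  lra.
by move=> /H[_ /andP[]]; rewrite mulr1; lra.
Qed.

(** The reflection of [y] to [- y] exchanges the two boundary rays and reduces this to the left
    one. *)
Lemma wedge_tight_right (K : rcfType) (l u b1 b2 : K) :
  l <= u -> describes_wedge l u b1 b2 -> b1 + b2 * u = Num.sqrt (1 + u ^+ 2).
Proof.
move=> lu H; rewrite -[u ^+ 2]sqrrN -(@wedge_tight_left K (- u) (- l) b1 (- b2)).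
- by rewrite mulrNN.
- by rewrite lerN2.
move=> x y; rewrite -[y ^+ 2]sqrrN mulNr -mulrN.
apply: (iff_trans (H x (- y))).
by rewrite !mulNr [- (u * x) <= _]lerNl [y <= _]lerNr [(- y <= _) && _]andbC.
Qed.

Lemma wedge_unique (K : rcfType) (l u b1 b2 c1 c2 : K) :
    l <= u -> describes_wedge l u b1 b2 -> describes_wedge l u c1 c2 ->
  b1 = c1 /\ b2 = c2.
Proof.
move=> lu Hb Hc.
have bl := wedge_tight_left lu Hb.
have cl := wedge_tight_left lu Hc.
have bu := wedge_tight_right lu Hb.
have cu := wedge_tight_right lu Hc.
suff b2c2 : b2 = c2 by split=> //; move: bl; rewrite -cl b2c2 => /addIr.
have [lequ|lneu] := eqVneq l u; last first.
  have : (b2 - c2) * (l - u) = 0 by lra.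
  by move/eqP; rewrite mulf_eq0 !subr_eq0 (negPf lneu) orbF => /eqP.
(* On a single ray a describing vector is [(1, l) / s] plus a multiple [c] of the
   normal [(- l, 1)], and [(1, l) + c (- l, 1)] is in the cone. *)
suff E b b' : describes_wedge l u b b' -> b + b' * l = Num.sqrt (1 + l ^+ 2) ->
    b' = l / Num.sqrt (1 + l ^+ 2).
  by rewrite (E _ _ Hb bl) (E _ _ Hc cl).
set s := Num.sqrt _ => H bE.
have s2 : s ^+ 2 = 1 + l ^+ 2 := sqr_sqrt1D l.
have s1 : 1 <= s by rewrite -sqrtr1 ler_sqrt ?lerDl ?sqr_ge0 // addr_ge0 ?sqr_ge0.
have s0 : s != 0 by rewrite gt_eqF //; lra.
(* The normal component of [(b, b')] is [c * s ^+ 2]. At [(1, l) + c (- l, 1)] the form is then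
   [s + c ^+ 2 * s ^+ 4], while the norm is [s] times the root of [1 + c ^+ 2]; since [s >= 1], the
   form dominates. *)
pose c := (b' - l / s) / s ^+ 2.
have b'E : b' = l / s + c * s ^+ 2 by rewrite /c; field.
have bE' : b = s - b' * l by rewrite -bE addrK.
have scs : b * (1 - c * l) + b' * (l + c) = s + c * (b' * (1 + l ^+ 2) - s * l).
  by rewrite bE'; ring.
have val : b * (1 - c * l) + b' * (l + c) = s + c ^+ 2 * s ^+ 4.
  by rewrite scs -s2 b'E; field.
have : Num.sqrt ((1 - c * l) ^+ 2 + (l + c) ^+ 2) <= b * (1 - c * l) + b' * (l + c).
  rewrite val ler_sqrtl.
  have c4 : 0 <= c ^+ 2 * s ^+ 4 by rewrite mulr_ge0 ?exprn_even_ge0.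
  have -> /= : 0 <= s + c ^+ 2 * s ^+ 4 by lra.
  have -> : (1 - c * l) ^+ 2 + (l + c) ^+ 2 = s ^+ 2 + c ^+ 2 * s ^+ 2.
    by rewrite s2; ring.
  have -> : (s + c ^+ 2 * s ^+ 4) ^+ 2
     = s ^+ 2 + c ^+ 2 * s ^+ 2 * (2 * s ^+ 3) + (c ^+ 2 * s ^+ 4) ^+ 2 by ring.
  have s3 : 1 <= s ^+ 3 by rewrite exprn_ege1.
  have : 0 <= c ^+ 2 * s ^+ 2 by rewrite mulr_ge0 ?sqr_ge0.
  have := sqr_ge0 (c ^+ 2 * s ^+ 4).
  nra.
move=> /H[_]; rewrite -lequ -eq_le => /eqP lc.
have : c * s ^+ 2 = 0 by rewrite s2; lra.
by move=> c0; rewrite b'E c0 addr0.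
Qed.

(** * From column vectors to coordinates *)

Lemma enorm2E (K : rcfType) (v : 'cV[K]_2) :
  enorm v = Num.sqrt (v 0 0 ^+ 2 + v 1 0 ^+ 2).
Proof.
rewrite /enorm !big_ord_recl big_ord0 addr0.
by rewrite (_ : lift ord0 ord0 = 1 :> 'I_2) //; apply: val_inj.
Qed.

Lemma dot2E (K : rcfType) (b v : 'cV[K]_2) :
  (b^T *m v) 0 0 = b 0 0 * v 0 0 + b 1 0 * v 1 0.
Proof.
rewrite !mxE !big_ord_recl big_ord0 addr0 !mxE.
by rewrite (_ : lift ord0 ord0 = 1 :> 'I_2) //; apply: val_inj.
Qed.

Definition col2 (K : rcfType) (x y : K) : 'cV[K]_2 :=
  \col_i if i == 0 then x else y.

Lemma col2_eq (K : rcfType) (b c : 'cV[K]_2) :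
  b 0 0 = c 0 0 -> b 1 0 = c 1 0 -> b = c.
Proof.
move=> e0 e1; apply/colP => -[[|[|//]] i2].
  by rewrite (_ : Ordinal i2 = 0) //; apply: val_inj.
by rewrite (_ : Ordinal i2 = 1) //; apply: val_inj.
Qed.

Lemma describes_coneE (K : rcfType) (L U : bounds K) (b : 'cV[K]_2) :
  describes_cone L U b <->
  describes_wedge (d12 L) (d12 U) (b 0 0) (b 1 0).
Proof.
split=> H.
  by move=> x y; have := H (col2 x y); rewrite enorm2E dot2E !mxE.
by move=> v; rewrite enorm2E dot2E; apply: H.
Qed.

Definition cone_vec (K : rcfType) (L U : bounds K) : 'cV[K]_2 :=
  let p := f (d12 L) in let q := f (d12 U) in
  col2 ((1 - p * q) / (1 + p * q)) ((p + q) / (1 + p * q)).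

Lemma describes_cone_vec (K : rcfType) (L U : bounds K) :
  d12 L <= d12 U -> describes_cone L U (cone_vec L U).
Proof.
move=> h12; apply/describes_coneE => x y; rewrite !mxE /=.
by apply: half_angle_cone; rewrite ?f_norm_lt1 ?f_double.
Qed.

Lemma describes_cone_unique (K : rcfType) (L U : bounds K) (b c : 'cV[K]_2) :
    d12 L <= d12 U -> describes_cone L U b -> describes_cone L U c ->
  b = c.
Proof.
move=> h12 /describes_coneE Hb /describes_coneE Hc.
by have [? ?] := wedge_unique h12 Hb Hc; apply: col2_eq.
Qed.

(** * Points of (S) as images of lifted vectors *)

Lemma tailored_setE (K : rcfType) (L U : bounds K) (b : 'cV[K]_2) (x : 'cV[K]_3) :
    0 <= d11 U -> describes_cone L U b ->
  tailored_set L U b x <->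
  [/\ d11 L <= x 0 0 ^+ 2 + x 1 0 ^+ 2 <= d11 U,
      0 <= x 0 0 /\ d12 L * x 0 0 <= x 1 0 <= d12 U * x 0 0
    & Num.sqrt (d22 L) <= x 2 0 <= Num.sqrt (d22 U)].
Proof.
move=> U0 Hb; rewrite /tailored_set; set v := usubmx _.
have v0 : v 0 0 = x 0 0 by rewrite mxE; congr (x _ _); apply: val_inj.
have v1 : v 1 0 = x 1 0 by rewrite mxE; congr (x _ _); apply: val_inj.
have n0 : 0 <= x 0 0 ^+ 2 + x 1 0 ^+ 2 by rewrite addr_ge0 ?sqr_ge0.
have := Hb v; rewrite enorm2E v0 v1 !ler_sqrt // => Hv.
by split=> -[? ? ?]; split=> //; apply/Hv.
Qed.

Lemma point_of_outer (K : rcfType) (x : 'cV[K]_3) :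
  point_of (x *m x^T) =
  Point (x 0 0 ^+ 2 + x 1 0 ^+ 2) (x 2 0 ^+ 2) (x 0 0 * x 2 0) (x 1 0 * x 2 0).
Proof. by rewrite /point_of !mxE !big_ord1 !mxE !expr2. Qed.

Definition col3 (K : rcfType) (x y z : K) : 'cV[K]_3 :=
  \col_i if i == 0 then x else if i == 1 then y else z.

(** A point of (S) is lifted by taking the root of [W22] as third coordinate and dividing [W12],
    [T12] by it; the quadratic equation then gives the norm of the first two. Conversely, the cone
    inequalities are multiplied by the nonnegative third coordinate. *)
Lemma system_S_tailored (K : rcfType) (L U : bounds K) (b : 'cV[K]_2)
    (w : point K) :
    d11 L <= d11 U -> d22 L <= d22 U -> d12 L <= d12 U ->
    0 <= d11 L -> 0 <= d22 L -> describes_cone L U b ->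
  system_S L U w <->
  exists2 x : 'cV[K]_3, tailored_set L U b x & w = point_of (x *m x^T).
Proof.
move=> h11 h22 h12 L1 L2 Hb.
have U1 := le_trans L1 h11; have U2 := le_trans L2 h22.
split=> [|[x /(tailored_setE _ U1 Hb)]]; last first.
  case=> x12 [x0 /andP[x1l x1u]] /andP[x3l x3u] ->.
  have z0 : 0 <= x 2 0 by apply: le_trans x3l; apply: sqrtr_ge0.
  rewrite point_of_outer /system_S /=; split=> //.
  - have zE : x 2 0 = Num.sqrt (x 2 0 ^+ 2) by rewrite sqrtr_sqr ger0_norm.
    by move: x3l x3u; rewrite zE !ler_sqrt ?sqr_ge0 // -zE => -> ->.
  - by rewrite !mulrA !ler_wpM2r.
  - exact: mulr_ge0.
  - by ring.
case: w => w1 w2 wc wt; rewrite /system_S /= => -[w1b w2b /andP[tl tu] c0 E].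
have /andP[w1l w1u] := w1b; have /andP[w2l w2u] := w2b.
have w10 := le_trans L1 w1l; have w20 := le_trans L2 w2l.
pose z := Num.sqrt w2.
have z2 : z ^+ 2 = w2 by rewrite sqr_sqrtr.
have zb : Num.sqrt (d22 L) <= z <= Num.sqrt (d22 U).
  by rewrite !ler_sqrt // w2l.
have [w2eq0|w2n0] := eqVneq w2 0.
  (* [W22 = 0] forces [x_3 = 0] and leaves the direction of (x_1, x_2) free. *)
  have z0 : z = 0 by rewrite /z w2eq0 sqrtr0.
  have [cE tE] : wc = 0 /\ wt = 0.
    move/eqP: E; rewrite w2eq0 mulr0 eq_sym paddr_eq0 ?sqr_ge0 // !sqrf_eq0.
    by case/andP => /eqP -> /eqP ->.
  pose l := d12 L.
  have s0 : 0 < 1 + l ^+ 2 by rewrite ltr_wpDr ?sqr_ge0.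
  (* Scaled so that [(a, l * a)], on the lower boundary ray, has squared norm [w1]. *)
  pose a := Num.sqrt (w1 / (1 + l ^+ 2)).
  have a0 : 0 <= a by apply: sqrtr_ge0.
  have aE : a ^+ 2 + (l * a) ^+ 2 = w1.
    rewrite (_ : _ + _ = a ^+ 2 * (1 + l ^+ 2)); last by ring.
    by rewrite sqr_sqrtr ?divr_ge0 ?(ltW s0) // divfK // gt_eqF.
  exists (col3 a (l * a) z); last first.
    by rewrite point_of_outer !mxE /= aE z2 z0 !mulr0 cE tE.
  apply/(tailored_setE _ U1 Hb); rewrite !mxE /= aE.
  by split=> //; split=> //; rewrite lexx ler_wpM2r.
have z0 : 0 < z by rewrite sqrtr_gt0 lt_neqAle eq_sym w2n0.
have nE : (wc / z) ^+ 2 + (wt / z) ^+ 2 = w1.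
  by rewrite !expr_div_n -mulrDl z2 -E mulfK.
exists (col3 (wc / z) (wt / z) z); last first.
  by rewrite point_of_outer !mxE /= nE z2 !divfK // gt_eqF.
apply/(tailored_setE _ U1 Hb); rewrite !mxE /= nE.
split=> //; split; first by rewrite divr_ge0 // ltW.
by rewrite !mulrA !ler_pM2r ?invr_gt0 // tl.
Qed.

(** * Comparison of coefficients *)

Lemma pi3E (K : rcfType) (L U : bounds K) :
  pi3 L U = (Num.sqrt (d11 L) + Num.sqrt (d11 U))
            * (Num.sqrt (d22 L) + Num.sqrt (d22 U)) * cone_vec L U 0 0.
Proof. by rewrite mxE. Qed.

Lemma pi4E (K : rcfType) (L U : bounds K) :
  pi4 L U = (Num.sqrt (d11 L) + Num.sqrt (d11 U))
            * (Num.sqrt (d22 L) + Num.sqrt (d22 U)) * cone_vec L U 1 0.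
Proof. by rewrite mxE. Qed.

Theorem theorem2 (K : rcfType) (L U : bounds K)
    (h11 : d11 L <= d11 U) (h22 : d22 L <= d22 U) (h12 : d12 L <= d12 U)
    (hL11 : 0 <= d11 L) (hL22 : 0 <= d22 L) :
  (exists! b : 'cV[K]_2, describes_cone L U b) /\
  (forall b : 'cV[K]_2, describes_cone L U b ->
    [/\ (forall w : point K,
           system_S L U w <->
           exists2 x : 'cV[K]_3, tailored_set L U b x & w = point_of (x *m x^T)),
        same_ineq (@sym_mx K 3)
          (ineq_comp (A1 L U) (@point_of K)) (B1_tailored L U b)
      & same_ineq (@sym_mx K 3)
          (ineq_comp (A2 L U) (@point_of K)) (B2_tailored L U b)]).
Proof.
have bV := describes_cone_vec h12; split.
  by exists (cone_vec L U); split=> // c; apply: describes_cone_unique.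
move=> b Hb; split; first by move=> w; apply: system_S_tailored.
(* By uniqueness [b] is [cone_vec L U], whose entries are the fractions in [pi3] and [pi4]. *)
all: rewrite -(describes_cone_unique h12 bV Hb) => X _ /=.
all: rewrite pi3E pi4E /pi0 /pi1 /pi2 !sqrtrM ?mulr_ge0 ?(le_trans hL11 h11) //.
all: move: (sqr_sqrtr hL11) (sqr_sqrtr (le_trans hL11 h11)).
all: move: (sqr_sqrtr hL22) (sqr_sqrtr (le_trans hL22 h22)).
all: set r := Num.sqrt (d11 L); set R := Num.sqrt (d11 U).
all: set lam := Num.sqrt (d22 L); set mu := Num.sqrt (d22 U) => lam2 mu2 r2 R2.
(* Outside the roots, (A1) contains only upper bounds and (A2) only lower ones; written as squares
   they leave polynomial identities in [r], [R], [lam], [mu] and the entries of [b] and [X]. *)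
- by rewrite -mu2 -R2; ring.
- by rewrite -lam2 -r2; ring.
Qed.
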